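(* Let $d\ge 2$, let $\mathcal{H}$ be a $d$-dimensional complex Hilbert space, and let $\mathbb{P}=\{\mathcal{P}^{(1)},\ldots,\mathcal{P}^{(M)}\}$ be a set of $M$ mutually unbiased measurements of efficiency $\varkappa$ on $\mathcal{H}$. Then for every $\alpha\in[2,\infty]$ and every density matrix $\rho$ on $\mathcal{H}$, $$\frac{1}{M}\sum_{\mathcal{P}\in\mathbb{P}} R_{\alpha}(\mathcal{P}|\rho)\;\geq\;\frac{1}{\alpha-1}\,\ln\!\left(\frac{Md(d-1)}{M(d-1)+(\varkappa d-1)\bigl(\mathrm{Tr}(\rho^{2})d-1\bigr)}\right)+\frac{\alpha-2}{\alpha-1}\left\{\ln d-\ln\!\left(1+M^{-1/2}\sqrt{\varkappa d-1}\,\sqrt{\mathrm{Tr}(\rho^{2})d-1}\right)\right\},$$ where for $\alpha=\infty$ the coefficients are understood as their limits, $\frac{1}{\alpha-1}=0$ and $\frac{\alpha-2}{\alpha-1}=1$.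
   Context: A density matrix on $\mathcal{H}$ is a positive semidefinite operator $\rho$ with $\mathrm{Tr}(\rho)=1$. A POVM with $d$ elements is a family of positive semidefinite operators $\{P_n\}_{n=1}^d$ on $\mathcal{H}$ with $\sum_n P_n=I$ (the identity). A set $\mathbb{P}=\{\mathcal{P}^{(1)},\ldots,\mathcal{P}^{(M)}\}$ of POVMs $\mathcal{P}^{(b)}=\{P^{(b)}_n\}_{n=1}^d$, each with $d$ elements (an indexed family, $b=1,\dots,M$), is a set of $M$ mutually unbiased measurements (MUMs) of efficiency $\varkappa$ if: (i) $\mathrm{Tr}(P^{(b)}_n)=1$ for all $b,n$; (ii) $\mathrm{Tr}(P^{(a)}_mP^{(b)}_n)=\frac1d$ for all $a\neq b$ and all $m,n$; (iii) for all $b,m,n$, $\mathrm{Tr}(P^{(b)}_mP^{(b)}_n)=\delta_{mn}\,\varkappa+(1-\delta_{mn})\frac{1-\varkappa}{d-1}$. Here $\varkappa$ is a real parameter, for which $1/d\le\varkappa\le 1$. Sums over $\mathcal{P}\in\mathbb{P}$ mean sums over $b=1,\dots,M$. For a POVM $\mathcal{P}=\{P_n\}_{n=1}^d$ and density matrix $\rho$, the outcome probabilities are $p_n(\mathcal{P}|\rho)=\mathrm{Tr}(P_n\rho)$, and $R_\alpha(\mathcal{P}|\rho)$ denotes the Rényi $\alpha$-entropy of this distribution: $R_{\alpha}(p)=\frac{1}{1-\alpha}\ln\left(\sum_n p_n^{\alpha}\right)$ for finite $\alpha>0$, $\alpha\neq1$, and $R_\infty(p)=-\ln(\max_n p_n)$.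 *)

(* Defs.v *)
From HB Require Import structures.
From mathcomp Require Import all_boot all_order all_algebra.
From mathcomp Require Import complex.
From mathcomp Require Import all_classical all_reals all_analysis.

Set Implicit Arguments.
Unset Strict Implicit.
Unset Printing Implicit Defensive.

Import Order.TTheory GRing.Theory Num.Theory.

Local Open Scope ring_scope.
Local Open Scope complex_scope.
Local Open Scope sesquilinear_scope.

(* Operators on an n-dimensional complex Hilbert space are written as matrices
   in an orthonormal basis, with vectors as columns.  In R[i], 0 <= z says that
   z is real and nonnegative, so the condition below also forces A to be
   Hermitian. *)
Definition psdmx (R : realType) (n : nat) (A : 'M[R[i]]_n) : Prop :=
  forall v : 'cV[R[i]]_n, 0 <= (v ^t* *m A *m v) 0 0.

Definition density_matrix (R : realType) (n : nat) (rho : 'M[R[i]]_n) : Prop :=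
  psdmx rho /\ \tr rho = 1.

Definition povm (R : realType) (n k : nat) (P : 'I_k -> 'M[R[i]]_n) : Prop :=
  (forall j, psdmx (P j)) /\ \sum_j P j = 1%:M.

Definition mum (R : realType) (d M : nat) (kappa : R)
    (P : 'I_M -> 'I_d -> 'M[R[i]]_d) : Prop :=
  [/\ forall b, povm (P b),
      forall b n, \tr (P b n) = 1,
      forall a b m n, a != b -> \tr (P a m *m P b n) = d%:R^-1
    & forall b m n, \tr (P b m *m P b n) =
        (if m == n then kappa else (1 - kappa) / (d%:R - 1))%:C].

(* The trace is real for positive semidefinite factors; the real part only
   changes its type from R[i] to R. *)
Definition outcome_prob (R : realType) (n k : nat) (P : 'I_k -> 'M[R[i]]_n)
    (rho : 'M[R[i]]_n) (j : 'I_k) : R :=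
  complex.Re (\tr (P j *m rho)).

Definition purity (R : realType) (n : nat) (rho : 'M[R[i]]_n) : R :=
  complex.Re (\tr (rho *m rho)).

(* Meaningful for 0 < alpha and alpha != 1; other values are placeholders.
   The default 0 of the maximum is neutral as probabilities are nonnegative. *)
Definition renyi_entropy (R : realType) (k : nat) (alpha : \bar R)
    (p : 'I_k -> R) : R :=
  match alpha with
  | EFin a => (1 - a)^-1 * ln (\sum_j p j `^ a)
  | +oo%E => - ln (\big[Num.max/0]_j p j)
  | -oo%E => 0
  end.

(* 1 / (alpha - 1), and its limit 0 at infinity. *)
Definition coef_inv (R : realType) (alpha : \bar R) : R :=
  if alpha is EFin a then (a - 1)^-1 else 0.

(* (alpha - 2) / (alpha - 1), and its limit 1 at infinity. *)
Definition coef_ratio (R : realType) (alpha : \bar R) : R :=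
  if alpha is EFin a then (a - 2) / (a - 1) else 1.

(* Main.v *)
(* Let p_(b,n) be the outcome probabilities and A the sum of the operators
   (p_(b,n) - 1/d) P^(b)_n.  The trace relations of mutually unbiased
   measurements make tr A^2 and tr (A rho) multiples of
   S = \sum_(b,n) (p_(b,n) - 1/d)^2, so tr (rho - I/d - t A)^2 >= 0 for a suitable real
   t bounds S by (kappa d - 1)(tr rho^2 d - 1) / (d (d - 1)).  By Cauchy-Schwarz
   this also bounds the sum over b of the maxima of p_(b,.).  The theorem follows
   from \sum_n p_n^alpha <= (max p)^(alpha-2) \sum_n p_n^2 and the concavity of ln. *)

Require Import Defs.
From HB Require Import structures.
From mathcomp Require Import all_boot all_order all_algebra.
From mathcomp Require Import complex.
From mathcomp Require Import all_classical all_reals all_analysis.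
From mathcomp Require Import ring lra.

Set Implicit Arguments.
Unset Strict Implicit.
Unset Printing Implicit Defensive.

Import Order.TTheory GRing.Theory Num.Theory.

Local Open Scope ring_scope.

(** * Positive semidefinite matrices and traces of their products *)

Lemma quadratic_formE (C : numClosedFieldType) (n : nat) (A : 'M[C]_n)
    (i j : 'I_n) (c : C) (v := delta_mx i 0 + c *: delta_mx j 0 : 'cV[C]_n) :
  (map_mx Num.conj v^T *m A *m v) 0 0 =
    A i i + c * A i j + (c^* * A j i + c^* * c * A j j).
Proof.
have -> : map_mx Num.conj v^T = delta_mx 0 i + c^* *: delta_mx 0 j.
  by rewrite /v linearD /= linearZ /= !trmx_delta map_mxD map_mxZ !map_delta_mx.
rewrite /v !mulmxDl -!scalemxAl !mulmxDr -!scalemxAr -!rowE -!colE.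
by rewrite !mxE mulrDr !mulrA.
Qed.

(** A complex quadratic form with only real values comes from a Hermitian matrix; the order of
    [R[i]] supplies the realness. *)
Lemma psdmx_hermitian (R : realType) (n : nat) (A : 'M[R[i]]_n) :
  psdmx A -> forall i j, (A i j)^* = A j i.
Proof.
move=> psdA i j.
have realA c : (A i i + c * A i j + (c^* * A j i + c^* * c * A j j))^* =
    A i i + c * A i j + (c^* * A j i + c^* * c * A j j).
  by apply/conj_Creal/ger0_real; rewrite -quadratic_formE; exact: psdA.
have diagA k : (A k k)^* = A k k.
  apply/conj_Creal/ger0_real.
  have := psdA (delta_mx k 0).
  by rewrite trmx_delta map_delta_mx -rowE -colE !mxE.
(* Polarization: the vectors e_i + c e_j with c = 1 and c = 'i suffice. *)
have := realA 1; have := realA 'i.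
rewrite !rmorphD !rmorphM /= !conjCK !diagA conjCi rmorph1.
set a := (A i j)^*; set b := (A j i)^* => Hi H1.
have i2 : 'i * 2 != 0 :> R[i] by rewrite mulf_neq0 ?neq0Ci ?pnatr_eq0.
apply: (mulfI i2); apply: subr0_eq.
set l1 := (X in X = _) in H1; set r1 := (X in _ = X) in H1.
set li := (X in X = _) in Hi; set ri := (X in _ = X) in Hi.
(* This combination cancels [b] and [A i j] and leaves ['i * 2] times [a - A j i]. *)
transitivity ('i * (l1 - r1) - (li - ri)); first by rewrite /l1 /r1 /li /ri; ring.
by rewrite H1 Hi !subrr mulr0 subrr.
Qed.

(** For Hermitian [A] this trace is the sum of the squared moduli of the entries. *)
Lemma hermitian_tr_sqr_ge0 (C : numClosedFieldType) (n : nat) (A : 'M[C]_n) :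
  (forall i j, (A i j)^* = A j i) -> 0 <= \tr (A *m A).
Proof.
move=> hA; apply: sumr_ge0 => i _; rewrite mxE.
by apply: sumr_ge0 => j _; rewrite -(hA i j) mul_conjC_ge0.
Qed.

(** In an orthonormal eigenbasis of [B] the trace is a sum of eigenvalues of [B] times diagonal
    entries of [A]. *)
Lemma psdmx_tr_mul_ge0 (R : realType) (n : nat) (A B : 'M[R[i]]_n) :
  psdmx A -> psdmx B -> 0 <= \tr (A *m B).
Proof.
move=> psdA psdB.
have : B \is hermsymmx.
  apply/is_hermitianmxP; rewrite expr0 scale1r; apply/matrixP => i j.
  by rewrite !mxE (psdmx_hermitian psdB).
move=> /hermitian_normalmx/orthomx_spectralP.
set U := spectralmx B; set s := spectral_diag B => BE.
have UU : U \is unitarymx by exact: spectral_unitarymx.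
rewrite invmx_unitary // in BE.
have diagE k : s 0 k = (U *m B *m map_mx Num.conj U^T) k k.
  rewrite BE -(invmx_unitary UU) !mulmxA mulmxV ?spectral_unit// mul1mx.
  by rewrite mulmxK ?spectral_unit// mxE eqxx.
(* These diagonal entries are values of the quadratic form of [X]; by [diagE] the case of [B] covers
   the eigenvalues. *)
have rowU_ge0 X k : psdmx X -> 0 <= (U *m X *m map_mx Num.conj U^T) k k.
  move=> /(_ (map_mx Num.conj (row k U)^T)).
  rewrite -map_trmx trmxK -map_mx_comp (map_mx_id (@conjCK _)).
  congr (_ <= _).
  by rewrite -row_mul !mxE; apply: eq_bigr => l _; rewrite !mxE.
rewrite BE !mulmxA mxtrace_mulC !mulmxA; apply: sumr_ge0 => k _.
by rewrite mul_mx_diag mxE mulr_ge0 ?rowU_ge0// diagE rowU_ge0.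
Qed.

(** * Outcome probabilities *)

Lemma outcome_probE (R : realType) (n k : nat) (P : 'I_k -> 'M[R[i]]_n)
    (rho : 'M[R[i]]_n) (j : 'I_k) :
  povm P -> density_matrix rho ->
  \tr (P j *m rho) = (outcome_prob P rho j)%:C%C.
Proof.
move=> [psdP _] [psd_rho _].
by apply/esym/RRe_real/ger0_real/psdmx_tr_mul_ge0.
Qed.

Lemma outcome_prob_ge0 (R : realType) (n k : nat) (P : 'I_k -> 'M[R[i]]_n)
    (rho : 'M[R[i]]_n) (j : 'I_k) :
  povm P -> density_matrix rho -> 0 <= outcome_prob P rho j.
Proof.
move=> povmP rhoP; rewrite -ler0c -outcome_probE//.
by apply: psdmx_tr_mul_ge0; [exact: povmP.1|exact: rhoP.1].
Qed.

Lemma sum_outcome_prob (R : realType) (n k : nat) (P : 'I_k -> 'M[R[i]]_n)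
    (rho : 'M[R[i]]_n) :
  povm P -> density_matrix rho -> \sum_j outcome_prob P rho j = 1.
Proof.
move=> povmP rhoP; apply: (@complexI R); rewrite rmorph_sum /=.
under eq_bigr do rewrite -outcome_probE//.
transitivity (\tr ((\sum_j P j) *m rho)); first by rewrite mulmx_suml raddf_sum.
by rewrite povmP.2 mul1mx rhoP.2.
Qed.

(** * Deviation of the outcome probabilities from uniformity *)

(** This is Bessel's inequality: when [kappa * d] exceeds 1, a multiple of [A] is the
    Hilbert-Schmidt projection of [rho - I/d] onto the span of the [P b n]. *)
Lemma mum_coincidence_le (R : realType) (d M : nat) (kappa : R)
    (P : 'I_M -> 'I_d -> 'M[R[i]]_d) (rho : 'M[R[i]]_d) :
  (2 <= d)%N -> d%:R^-1 <= kappa -> mum kappa P -> density_matrix rho ->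
  \sum_b \sum_n (outcome_prob (P b) rho n - d%:R^-1) ^+ 2 <=
    (kappa * d%:R - 1) * (purity rho * d%:R - 1) / (d%:R * (d%:R - 1)).
Proof.
move=> hd hkappa [povmP trP trPab trPb] [psd_rho tr_rho].
have d_gt0 : 0 < d%:R :> R by rewrite ltr0n (leq_trans _ hd).
have d1_gt0 : 0 < d%:R - 1 :> R by rewrite subr_gt0 ltr1n.
pose x b n := outcome_prob (P b) rho n - d%:R^-1.
set S := \sum_b _; set K := kappa * d%:R - 1; set T := purity rho * d%:R - 1.
have K_ge0 : 0 <= K by rewrite subr_ge0 -ler_pdivrMr// mul1r.
have rhoP : density_matrix rho by [].
have probE b n := outcome_probE n (povmP b) rhoP.
have purityE : \tr (rho *m rho) = (purity rho)%:C%C.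
  by apply/esym/RRe_real/ger0_real/psdmx_tr_mul_ge0.
have sum_x b : \sum_n x b n = 0.
  rewrite sumrB sumr_const card_ord -[_ *+ d]mulr_natr mulVf ?gt_eqF//.
  by rewrite sum_outcome_prob ?subrr.
pose A := \sum_b \sum_n (x b n)%:C%C *: P b n.
have trA X : \tr (A *m X) = \sum_b \sum_n (x b n)%:C%C * \tr (P b n *m X).
  rewrite mulmx_suml raddf_sum; apply: eq_bigr => b _.
  rewrite mulmx_suml raddf_sum; apply: eq_bigr => n _.
  by rewrite -scalemxAl /= mxtraceZ.
have trA1 : \tr A = 0.
  rewrite -[A]mulmx1 trA big1// => b _.
  under eq_bigr do rewrite mulmx1 trP mulr1.
  by rewrite -rmorph_sum sum_x.
(* Since each [x b] sums to zero, the constant overlaps between different measurements cancel.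
   Within one measurement [x b n] gets the factor [kappa - (1 - kappa) / (d - 1)], which is
   [K / (d - 1)]. *)
have trAP b n : \tr (A *m P b n) = (x b n * (K / (d%:R - 1)))%:C%C.
  rewrite trA (bigD1 b) //= [X in _ + X]big1 ?addr0; last first.
    move=> a ab; under eq_bigr do rewrite trPab//.
    by rewrite -mulr_suml -rmorph_sum sum_x mul0r.
  under eq_bigr do rewrite trPb -rmorphM.
  rewrite -rmorph_sum (bigD1 n) //= eqxx; congr (_ %:C)%C.
  have -> : \sum_(m | m != n) x b m * (if m == n then kappa else (1 - kappa) / (d%:R - 1))
      = - x b n * ((1 - kappa) / (d%:R - 1)).
    have := sum_x b; rewrite (bigD1 n) //= => /eqP.
    rewrite addrC addr_eq0 => /eqP <-; rewrite mulr_suml.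
    by apply: eq_bigr => m /negbTE ->.
  by rewrite /K; field; rewrite gt_eqF.
have trAA : \tr (A *m A) = (S * (K / (d%:R - 1)))%:C%C.
  rewrite trA /S mulr_suml rmorph_sum; apply: eq_bigr => b _.
  rewrite mulr_suml rmorph_sum; apply: eq_bigr => n _.
  by rewrite mxtrace_mulC trAP -rmorphM expr2 -(mulrA (x b n)).
have trArho : \tr (A *m rho) = S%:C%C.
  rewrite trA /S rmorph_sum; apply: eq_bigr => b _.
  have -> : \sum_n (outcome_prob (P b) rho n - d%:R^-1) ^+ 2 =
      \sum_n x b n * outcome_prob (P b) rho n.
    transitivity (\sum_n x b n * outcome_prob (P b) rho n - (\sum_n x b n) * d%:R^-1).
      by rewrite mulr_suml -sumrB; apply: eq_bigr => n _; rewrite expr2 -mulrBr.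
    by rewrite sum_x mul0r subr0.
  by rewrite rmorph_sum; apply: eq_bigr => n _; rewrite probE -rmorphM.
(* [T / d] is the trace of the square of [rho - I/d]; the expression is the trace of [H *m H] as a
   polynomial in [t]. *)
have quad_ge0 t : 0 <= T / d%:R - 2 * t * S + t ^+ 2 * (S * (K / (d%:R - 1))).
  pose H := rho - (d%:R^-1)%:C%C%:M - t%:C%C *: A.
  have conjR (r : R) : (r%:C%C)^* = r%:C%C :> R[i].
    by apply/conj_Creal; rewrite complex_real.
  have : 0 <= \tr (H *m H).
    apply: hermitian_tr_sqr_ge0 => i j.
    rewrite !mxE !rmorphB rmorphM rmorphMn /= !conjR eq_sym.
    rewrite (psdmx_hermitian psd_rho) !summxE rmorph_sum.
    congr (_ - _ - _ * _); apply: eq_bigr => b _.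
    rewrite !summxE rmorph_sum; apply: eq_bigr => n _.
    by rewrite !mxE rmorphM /= conjR (psdmx_hermitian ((povmP b).1 n)).
  rewrite /H !mulmxBl !mulmxBr -!scalemxAl -!scalemxAr !mul_mx_scalar !mul_scalar_mx.
  rewrite !raddfB /= !mxtraceZ [\tr (rho *m A)]mxtrace_mulC trAA trArho purityE tr_rho trA1.
  rewrite mxtrace_scalar.
  have -> : (d%:R^-1)%:C%C *+ d = 1 :> R[i].
    by rewrite -rmorphMn /= -[_ *+ d]mulr_natr mulVf ?rmorph1// gt_eqF.
  rewrite !mulr1 !mulr0.
  set q := S * _; set u := d%:R^-1.
  have -> : T / d%:R = purity rho - u by rewrite mulrBl mul1r mulfK ?gt_eqF.
  set z := (X in 0 <= X -> _).
  have -> : z = (purity rho - u - 2 * t * S + t ^+ 2 * q)%:C%C.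
    by rewrite /z !(rmorphD, rmorphB, rmorphM, rmorphXn, rmorph_nat) /=; ring.
  by rewrite ler0c.
rewrite ler_pdivlMr ?mulr_gt0//.
(* If [K] vanishes, the polynomial is affine in [t], and a positive [S] would let it take the value
   [- 1]. *)
have [K0|K_neq0] := eqVneq K 0.
  have [//|S_gt0] := lerP S 0; first by rewrite K0 mul0r pmulr_lle0 ?mulr_gt0.
  have := quad_ge0 ((T / d%:R + 1) / (2 * S)).
  have -> : T / d%:R - 2 * ((T / d%:R + 1) / (2 * S)) * S = - 1.
    by field; rewrite !gt_eqF.
  by rewrite K0 mul0r !mulr0 addr0 lerNr oppr0 ler10.
have K_gt0 : 0 < K by rewrite lt0r K_neq0.
(* This [t] minimises the polynomial. *)
have := quad_ge0 ((d%:R - 1) / K).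
have -> : T / d%:R - 2 * ((d%:R - 1) / K) * S +
    ((d%:R - 1) / K) ^+ 2 * (S * (K / (d%:R - 1))) =
    (K * T - S * (d%:R * (d%:R - 1))) / (d%:R * K).
  by field; rewrite K_neq0 !gt_eqF.
by rewrite pmulr_lge0 ?invr_gt0 ?mulr_gt0// subr_ge0.
Qed.

(** * Inequalities for real sums and logarithms *)

(** Cauchy-Schwarz against the constant 1, from the squared deviations from the mean [s / n]. *)
Lemma sum_sqr_le (R : realFieldType) (I : finType) (P : pred I) (x : I -> R) :
  (\sum_(i | P i) x i) ^+ 2 <= #|P|%:R * \sum_(i | P i) x i ^+ 2.
Proof.
set s := \sum_(i | P i) x i; set n := #|P|%:R : R.
have [/eqP|n_gt0] := posnP #|P|.
  rewrite /s /n => n0; rewrite !big_pred0 ?mulr0 ?expr0n//=;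
  by move=> i; have /card0_eq/(_ i) := eqP n0.
have n0 : 0 < n by rewrite ltr0n.
have : 0 <= \sum_(i | P i) (x i - s / n) ^+ 2 by apply: sumr_ge0 => i _; exact: sqr_ge0.
have sqE i : (x i - s / n) ^+ 2 = x i ^+ 2 - 2 * (s / n) * x i + (s / n) ^+ 2 by ring.
under eq_bigr do rewrite sqE.
rewrite big_split /= sumrB -mulr_sumr sumr_const -/s -(mulr_natr ((s / n) ^+ 2)) -/n.
set q := \sum_(i | P i) x i ^+ 2.
have -> : q - 2 * (s / n) * s + (s / n) ^+ 2 * n = (n * q - s ^+ 2) / n.
  by field; rewrite gt_eqF.
by rewrite pmulr_lge0 ?invr_gt0// subr_ge0.
Qed.

(** The other [d - 1] entries sum to [- x j]; Cauchy-Schwarz applied to them alone gives the factor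
    [d - 1]. *)
Lemma sqr_le_sum_sqr (R : realFieldType) (d : nat) (x : 'I_d -> R) (j : 'I_d) :
  \sum_i x i = 0 -> d%:R * x j ^+ 2 <= (d%:R - 1) * \sum_i x i ^+ 2.
Proof.
move=> x0; have := sum_sqr_le (predC1 j) x.
have d1 : #|predC1 j|%:R = d%:R - 1 :> R.
  have := cardC1 j; rewrite card_ord => ->.
  by case: d x j x0 => [|d] x j _; [case: j|rewrite -[d.+1]addn1 natrD addrK addn1].
have -> : \sum_(i | predC1 j i) x i = - x j.
  by apply/eqP; rewrite -addr_eq0 addrC; move: x0; rewrite (bigD1 j) //= => ->.
rewrite d1 sqrrN [in X in _ -> X](bigD1 j) //= mulrDr => le_sum.
rewrite -[X in X * _](subrK 1) mulrDl mul1r; exact: lerD.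
Qed.

(** Jensen's inequality, by bounding [ln] by its tangent at [Y]. *)
Lemma sum_ln_le (R : realType) (M : nat) (y : 'I_M -> R) (Y : R) :
  0 < Y -> (forall b, 0 < y b) -> \sum_b y b <= M%:R * Y ->
  \sum_b ln (y b) <= M%:R * ln Y.
Proof.
move=> Y0 y0 yY.
have le_ln b : ln (y b) <= ln Y + (y b / Y - 1).
  have /le_ln1Dx : -1 < y b / Y - 1 by rewrite ltrBDl subrr divr_gt0.
  by rewrite addrC subrK ln_div ?posrE// lerBlDl.
apply: (le_trans (ler_sum _ (fun b _ => le_ln b))).
rewrite big_split sumrB -mulr_suml !sumr_const card_ord -[ln Y *+ _]mulr_natl.
by rewrite gerDl subr_le0 ler_pdivrMr.
Qed.

Lemma ln_sum_powR_le (R : realType) (k : nat) (a : R) (p : 'I_k -> R) :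
  2 <= a -> (forall j, 0 <= p j) -> 0 < \sum_j p j ->
  ln (\sum_j p j `^ a) <=
    (a - 2) * ln (\big[Num.max/0]_j p j) + ln (\sum_j p j ^+ 2).
Proof.
move=> a2 p0 sp; set m := \big[_/_]_j p j.
have [j pj] : exists j, 0 < p j.
  apply/existsP; apply: contraLR sp => /existsPn np.
  by rewrite -leNgt; apply: sumr_le0 => j _; rewrite leNgt np.
have m0 : 0 < m by apply: (lt_le_trans pj); exact: le_bigmax_cond.
have S0 : 0 < \sum_j p j ^+ 2.
  by rewrite (bigD1 j) //= ltr_wpDr ?exprn_gt0// sumr_ge0// => i _; exact: sqr_ge0.
have Sa0 : 0 < \sum_j p j `^ a.
  by rewrite (bigD1 j) //= ltr_wpDr ?powR_gt0// sumr_ge0// => i _; exact: powR_ge0.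
rewrite -ln_powR -lnM ?posrE ?powR_gt0// ler_ln ?posrE ?mulr_gt0 ?powR_gt0//.
rewrite mulr_sumr; apply: ler_sum => i _.
(* Splitting the power at base zero requires that the exponents not add to zero; their sum is [a],
   at least 2. *)
rewrite -[in leLHS](subrK 2 a) [in leLHS]powRD; last first.
  by rewrite subrK; apply/implyP => /eqP; lra.
rewrite powR_mulrn//; apply: ler_wpM2r; first exact: sqr_ge0.
by apply: ge0_ler_powR; rewrite ?nnegrE ?subr_ge0 ?(ltW m0)//; exact: le_bigmax_cond.
Qed.

(** * The averaged entropy bound *)

Theorem proposition3 (R : realType) (d M : nat) (kappa : R)
    (P : 'I_M -> 'I_d -> 'M[R[i]]_d) (alpha : \bar R) (rho : 'M[R[i]]_d)
    (hd : (2 <= d)%N) (hM : (0 < M)%N)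
    (hkappa : d%:R^-1 <= kappa <= 1)
    (hP : mum kappa P)
    (halpha : (2%:E <= alpha)%E)
    (hrho : density_matrix rho) :
  M%:R^-1 * \sum_(b < M) renyi_entropy alpha (outcome_prob (P b) rho) >=
    coef_inv alpha *
      ln (M%:R * d%:R * (d%:R - 1) /
          (M%:R * (d%:R - 1) + (kappa * d%:R - 1) * (purity rho * d%:R - 1)))
    + coef_ratio alpha *
      (ln d%:R
       - ln (1 + (Num.sqrt M%:R)^-1 * Num.sqrt (kappa * d%:R - 1)
                 * Num.sqrt (purity rho * d%:R - 1))).
Proof.
have d_gt0 : 0 < d%:R :> R by rewrite ltr0n (leq_trans _ hd).
have d1_gt0 : 0 < d%:R - 1 :> R by rewrite subr_gt0 ltr1n.
have M_gt0 : 0 < M%:R :> R by rewrite ltr0n.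
have kappa_ge : d%:R^-1 <= kappa by case/andP: hkappa.
have coinc := mum_coincidence_le hd kappa_ge hP hrho.
have povmP b : povm (P b) by case: hP.
have prob_ge0 b j := outcome_prob_ge0 j (povmP b) hrho.
have sum_prob b := sum_outcome_prob (povmP b) hrho.
set K := kappa * d%:R - 1 in coinc *; set T := purity rho * d%:R - 1 in coinc *.
set p := fun b => outcome_prob (P b) rho in coinc prob_ge0 sum_prob *.
have K_ge0 : 0 <= K by rewrite subr_ge0 -ler_pdivrMr// mul1r.
(* The left side of [coinc] is a sum of squares, which settles the sign of the product. *)
have V_ge0 : 0 <= K * T.
  have : 0 <= K * T / (d%:R * (d%:R - 1)).
    by apply: le_trans coinc; do 2!apply: sumr_ge0 => ? _; exact: sqr_ge0.
  by rewrite pmulr_lge0 ?invr_gt0 ?mulr_gt0.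
pose C b := \sum_j p b j ^+ 2.
pose m b := \big[Num.max/0]_j p b j.
have CE b : C b = d%:R^-1 + \sum_j (p b j - d%:R^-1) ^+ 2.
  have sqE j : (p b j - d%:R^-1) ^+ 2 = p b j ^+ 2 - 2 / d%:R * p b j + d%:R^-1 ^+ 2 by ring.
  under [in RHS]eq_bigr do rewrite sqE.
  rewrite big_split sumrB -mulr_sumr sum_prob sumr_const card_ord /= -/(C b).
  by rewrite -[_ *+ d]mulr_natr; field; rewrite gt_eqF.
have C_gt0 b : 0 < C b.
  by rewrite CE ltr_pwDl ?invr_gt0// sumr_ge0// => j _; exact: sqr_ge0.
(* The default 0 of the maximum does no harm: there is at least one outcome and all probabilities
   are nonnegative. *)
have m_attained b : {j | m b = p b j}.
  have j0 : 'I_d := Ordinal (ltnW hd).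
  have [j _ mE] := @eq_bigmax _ _ _ 0 j0 xpredT (p b) isT (fun j _ => prob_ge0 b j).
  by exists j.
have m_gt0 b : 0 < m b.
  rewrite lt0r; apply/andP; split; last by have [j ->] := m_attained b; exact: prob_ge0.
  apply/eqP => m0; have := sum_prob b; rewrite big1; first by lra.
  move=> j _; apply/le_anti; rewrite prob_ge0 andbT -m0; exact: le_bigmax_cond.
(* The reciprocal of the argument of the first logarithm in the statement; it bounds the mean of the
   [C b]. *)
pose Cbar := (M%:R * (d%:R - 1) + K * T) / (M%:R * d%:R * (d%:R - 1)).
have Cnum_gt0 : 0 < M%:R * (d%:R - 1) + K * T by rewrite ltr_pwDl ?mulr_gt0.
have Cbar_gt0 : 0 < Cbar by rewrite divr_gt0 ?mulr_gt0.
have sum_C : \sum_b C b <= M%:R * Cbar.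
  under eq_bigr do rewrite CE.
  rewrite big_split /= sumr_const card_ord -[_ *+ M]mulr_natr.
  have -> : M%:R * Cbar = d%:R^-1 * M%:R + K * T / (d%:R * (d%:R - 1)).
    by rewrite /Cbar; field; rewrite !gt_eqF.
  by rewrite lerD2l.
pose w := (Num.sqrt M%:R)^-1 * Num.sqrt K * Num.sqrt T.
have w_ge0 : 0 <= w by rewrite !mulr_ge0 ?invr_ge0 ?sqrtr_ge0.
have w_sqr : w ^+ 2 = K * T / M%:R.
  rewrite /w -mulrA -sqrtrM// exprMn exprVn !sqr_sqrtr ?(ltW M_gt0)//.
  by rewrite mulrC.
have sum_m : \sum_b m b <= M%:R * ((1 + w) / d%:R).
  (* Cauchy-Schwarz over [b] gives a factor [M], and within each measurement [(d - 1) / d]; the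
     [d - 1] cancels against the denominator in [coinc]. *)
  have dev : (\sum_b (m b - d%:R^-1)) ^+ 2 <= (M%:R * w / d%:R) ^+ 2.
    apply: (le_trans (sum_sqr_le _ _)); rewrite card_ord.
    have dev_b b : (m b - d%:R^-1) ^+ 2 <=
        (d%:R - 1) / d%:R * \sum_j (p b j - d%:R^-1) ^+ 2.
      have [j ->] := m_attained b.
      rewrite mulrAC ler_pdivlMr// [leLHS]mulrC.
      apply: (sqr_le_sum_sqr j); rewrite sumrB sum_prob sumr_const card_ord.
      by rewrite -[_ *+ d]mulr_natr mulVf ?subrr// gt_eqF.
    apply: (@le_trans _ _
      (M%:R * ((d%:R - 1) / d%:R * (K * T / (d%:R * (d%:R - 1)))))).
      rewrite ler_wpM2l ?(ltW M_gt0)//.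
      apply: (le_trans (ler_sum _ (fun b _ => dev_b b))).
      by rewrite -mulr_sumr ler_wpM2l ?divr_ge0 ?(ltW d_gt0) ?(ltW d1_gt0).
    have -> : (M%:R * w / d%:R) ^+ 2 = (M%:R / d%:R) ^+ 2 * w ^+ 2 by ring.
    rewrite w_sqr [leLHS](_ : _ = (M%:R / d%:R) ^+ 2 * (K * T / M%:R))//.
    by field; rewrite !gt_eqF.
  have : \sum_b (m b - d%:R^-1) <= M%:R * w / d%:R.
    have [|neg] := leP 0 (\sum_b (m b - d%:R^-1)).
      by move=> ?; move: dev; rewrite ler_sqr ?nnegrE ?divr_ge0 ?mulr_ge0 ?(ltW M_gt0) ?(ltW d_gt0).
    by rewrite (le_trans (ltW neg))// divr_ge0 ?mulr_ge0 ?(ltW M_gt0) ?(ltW d_gt0).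
  rewrite sumrB sumr_const card_ord -[_ *+ M]mulr_natr lerBlDr => /le_trans; apply.
  by lra.
have m_bound_gt0 : 0 < (1 + w) / d%:R by rewrite divr_gt0 ?ltr_pwDl.
have ln_C := sum_ln_le Cbar_gt0 C_gt0 sum_C.
have ln_m := sum_ln_le m_bound_gt0 m_gt0 sum_m.
rewrite ln_div ?posrE ?ltr_pwDl// in ln_m.
have -> : ln (M%:R * d%:R * (d%:R - 1) / (M%:R * (d%:R - 1) + K * T)) = - ln Cbar.
  by rewrite -lnV ?posrE// /Cbar invf_div.
rewrite -/w.
(* At infinity the bound on the maxima alone gives the claim. *)
case: alpha halpha => [a|_|//]; last first.
  rewrite /= mul0r add0r mul1r ler_pdivlMl// sumrN -/m.
  by rewrite lerNr; move: ln_m; lra.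
rewrite lee_fin /= => a2.
have a1_gt0 : 0 < a - 1 by lra.
rewrite ler_pdivlMl// -mulr_sumr.
(* Here [2 <= a] gives the bound on the maxima a nonnegative weight. *)
have ln_sum : \sum_b ln (\sum_j p b j `^ a) <=
    (a - 2) * (M%:R * (ln (1 + w) - ln d%:R)) + M%:R * ln Cbar.
  have ln_b b := ln_sum_powR_le a2 (prob_ge0 b) (eq_ind_r (fun s => 0 < s) ltr01 (sum_prob b)).
  apply: (le_trans (ler_sum _ (fun b _ => ln_b b))).
  rewrite big_split -mulr_sumr; apply: lerD => //.
  by rewrite ler_wpM2l ?subr_ge0.
(* The prefactor of the entropy is negative, so the upper bound [ln_sum] turns into a lower
   bound. *)
have -> : (1 - a)^-1 = - (a - 1)^-1 by rewrite -invrN opprB.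
have -> : (a - 1)^-1 * - ln Cbar + (a - 2) / (a - 1) * (ln d%:R - ln (1 + w)) =
    - ((a - 1)^-1 * (ln Cbar + (a - 2) * (ln (1 + w) - ln d%:R))) by ring.
rewrite mulrN !mulNr lerN2 mulrCA ler_pM2l ?invr_gt0//.
by apply: (le_trans ln_sum); lra.
Qed.
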